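(* Let $(\mathfrak X,\|\cdot\|)$ be a Banach space with dual $\mathfrak X^*$, let $(\Omega,\mathfrak L,\lambda)$ be a measure space, and let $\mathrm F:\mathfrak X\times\Omega\to\mathbb R$ be such that $\mathrm F(u,\cdot)\in L^\infty(\Omega,\lambda)$ for all $u\in\mathfrak X$ and $\mathrm F(\cdot,x)\in C^1(\mathfrak X)$ (in the Fréchet sense) for $\lambda$-a.e. $x\in\Omega$, with partial Fréchet differential $(\partial \mathrm F(\cdot,x))_u\in\mathfrak X^*$. Suppose that for every $v\in\mathfrak X$: (a) for every $\phi\in\mathfrak X$, $\lambda\text{-}\operatorname{ess\,sup}_{x\in\Omega}\big|[(\partial \mathrm F(\cdot,x))_w-(\partial \mathrm F(\cdot,x))_v](\phi)\big|\to0$ as $w\to v$ in $\mathfrak X$; (b) $\lambda\text{-}\operatorname{ess\,sup}_{x\in\Omega}|\mathrm F(w,x)-\mathrm F(v,x)|\to0$ as $w\to v$ in $\mathfrak X$. Suppose additionally that for any $R>0$ there exists $L(R)>0$ such that $$\lambda\text{-}\operatorname*{ess\,sup}_{\Omega}\big|\mathrm F(u,\cdot)-\mathrm F(v,\cdot)\big|\le L(R)\|u-v\|\qquad\text{when }u,v\in\mathbb B_R\subseteq\mathfrak X.$$ Then the envelope $f:\mathfrak X\to\mathbb R$, $f(u):=\lambda\text{-}\operatorname{ess\,sup}_{x\in\Omega}\mathrm F(u,x)$, is (everywhere, in every direction) Hadamard semi-differentiable as well as Penot semi-differentiable, and the corresponding stronger semi-differentials are given by $$(\mathfrak D f)^+_u(\phi)=\lim_{\varepsilon\to0^+}\Big(\lambda\text{-}\operatorname*{ess\,sup}_{x\in\Omega_\varepsilon(u)}(\partial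 \mathrm F(\cdot,x))_u(\phi)\Big),\qquad \Omega_\varepsilon(u):=\big\{\mathrm F(u,\cdot)\ge f(u)-\varepsilon\big\}.$$ Moreover, for any fixed $u\in\mathfrak X$, the semi-differential $(\mathfrak D f)^+_u:\mathfrak X\to\mathbb R$ is a positively $1$-homogeneous, continuous and convex functional.
   Context: $\mathbb B_R$ is the open ball of radius $R$ centred at the origin. A functional $f:\mathfrak X\to\mathbb R$ is (right) Gateaux semi-differentiable at $u$ in direction $\phi$ if $(\mathfrak D f)^+_u(\phi):=\lim_{t\to0^+}\frac{f(u+t\phi)-f(u)}t$ exists. It is (right) Penot semi-differentiable (also called $M$-semi-differentiable) at $u$ in direction $\phi$ if the limit exists in the stronger sense $(\mathfrak D f)^+_u(\phi)=\lim_{t\to0^+,\ \psi\to\phi\text{ in }\mathfrak X}\frac{f(u+t\psi)-f(u)}t$. It is (right) Hadamard semi-differentiable at $u$ in direction $\phi$ if $(\mathfrak D f)^+_u(\phi)=\lim_{t\to0^+}\frac{f(u(t))-f(u(0))}{t}$ for any path $u:[0,t_0)\to\mathfrak X$, $t_0>0$, satisfying $u(0)=u$ and $u'(0^+)=\phi$. *)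

(* Defs.v *)
From HB Require Import structures.
From mathcomp Require Import all_boot all_order all_algebra.
From mathcomp Require Import all_classical all_reals all_analysis.
From mathcomp Require Import ess_sup_inf hoelder convex.

Set Implicit Arguments.
Unset Strict Implicit.
Unset Printing Implicit Defensive.

Import Order.TTheory GRing.Theory Num.Theory.
Import numFieldNormedType.Exports.

Local Open Scope classical_set_scope.
Local Open Scope ring_scope.

(* The norm of the dual space, with values in \bar R: +oo on unbounded
   functionals. *)
Definition dual_norm (R : realType) (X : normedModType R) (l : X -> R) :
  \bar R := ereal_sup [set `|l phi|%:E | phi in [set phi | `|phi| <= 1]].

Definition continuously_differentiable (R : realType) (X : normedModType R)
    (g : X -> R) : Prop :=
  (forall u, differentiable g u) /\
  (forall v, dual_norm (fun phi => 'd g w phi - 'd g v phi)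
     @[w --> v] --> 0%E).

(* Essential supremum over a subset D; no measurability of D or f is assumed. *)
Definition ess_sup_on d (T : measurableType d) (R : realType)
    (mu : {measure set T -> \bar R}) (D : set T) (f : T -> \bar R) : \bar R :=
  ereal_inf [set y | {ae mu, forall x, D x -> (f x <= y)%E}].

Definition diff_quotient (R : realType) (X : normedModType R) (f : X -> R)
    (u phi : X) (t : R) : R := (f (u + t *: phi) - f u) / t.

(* A junk value when the limit does not exist. The two notions below force it to
   exist: they allow psi = phi, respectively c t = u + t *: phi. *)
Definition semidifferential (R : realType) (X : normedModType R) (f : X -> R)
    (u phi : X) : R := lim (diff_quotient f u phi t @[t --> 0^'+]).

Definition penot_semidifferentiable (R : realType) (X : normedModType R)
    (f : X -> R) (u phi : X) : Prop :=
  diff_quotient f u p.2 p.1 @[p --> (0^'+, nbhs phi)]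
    --> semidifferential f u phi.

(* A path c on [0, t0[ is encoded by an arbitrary extension to R, whose values
   outside of [0, t0[ play no role; c is only required to be right
   differentiable at 0, not to be continuous on ]0, t0[. *)
Definition hadamard_semidifferentiable (R : realType) (X : normedModType R)
    (f : X -> R) (u phi : X) : Prop :=
  forall (t0 : R) (c : R -> X), 0 < t0 -> c 0 = u ->
    t^-1 *: (c t - c 0) @[t --> 0^'+] --> phi ->
    (f (c t) - f (c 0)) / t @[t --> 0^'+] --> semidifferential f u phi.

(* fine is faithful only if the essential supremum is finite, e.g. when every
   F u is essentially bounded and mu setT > 0; otherwise it yields 0. *)
Definition envelope d (T : measurableType d) (R : realType)
    (mu : {measure set T -> \bar R}) (X : Type) (F : X -> T -> R) (u : X) : R :=
  fine (ess_sup mu (fun x => (F u x)%:E)).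

Definition almost_max d (T : measurableType d) (R : realType)
    (mu : {measure set T -> \bar R}) (X : Type) (F : X -> T -> R) (u : X)
    (eps : R) : set T :=
  [set x | envelope mu F u - eps <= F u x].

(* Main.v *)
(* For small t the mean value theorem gives F(u + t phi) = F(u) + t dF_u(phi)
   up to an error e t, for almost every x, and |dF_u| is essentially bounded by
   the Lipschitz constant. The essential supremum of such an expansion has
   right derivative lim ess sup of dF_u(phi) over Omega_eps(u): only points where
   F(u) is within O(t) of f(u) can compete. Since f is locally Lipschitz, the
   Gateaux derivative is a Penot one, hence a Hadamard one. Homogeneity,
   continuity and convexity all follow from one comparison principle: an a.e.
   bound of one slope by an affine combination of two others passes to the
   limits. *)
Require Import Defs.
From HB Require Import structures.
From mathcomp Require Import all_boot all_order all_algebra.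
From mathcomp Require Import all_classical all_reals all_analysis.
From mathcomp Require Import ess_sup_inf hoelder convex.
From mathcomp Require Import ring lra.

Set Implicit Arguments.
Unset Strict Implicit.
Unset Printing Implicit Defensive.

Import Order.TTheory GRing.Theory Num.Theory.
Import numFieldNormedType.Exports.
Local Open Scope classical_set_scope.
Local Open Scope ring_scope.

(** * Essential suprema over almost maximal points *)

(** Setting [f] to [-oo] off [D] turns this into an ordinary essential supremum, where the infimum
    of the a.e. bounds is attained. *)
Lemma ess_sup_onP d (T : measurableType d) (R : realType)
    (mu : {measure set T -> \bar R}) (D : set T) (f : T -> \bar R) (y : \bar R) :
  (ess_sup_on mu D f <= y)%E <-> {ae mu, forall x, D x -> (f x <= y)%E}.
Proof.
have E z : {ae mu, forall x, D x -> (f x <= z)%E} <->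
    {ae mu, forall x, ((if x \in D then f x else -oo) <= z)%E}.
  split; apply: filterS => x.
    by case: ifPn => [/set_mem Dx /(_ Dx)//|_ _]; rewrite leNye.
  by move=> + Dx; rewrite mem_set.
rewrite E; suff -> : ess_sup_on mu D f =
    ess_sup mu (fun x => if x \in D then f x else -oo)%E.
  by split => /ess_supP.
by congr ereal_inf; apply/seteqP; split => z /= /E.
Qed.

(* M is the limit of ess sup_{h >= m - eps} g as eps -> 0+, stated without
   extended reals. *)
Definition almost_max_slope d (T : measurableType d) (R : realType)
    (mu : {measure set T -> \bar R}) (h : T -> R) (m : R) (g : T -> R)
    (M : R) : Prop :=
  (forall eta, 0 < eta -> exists2 eps, 0 < eps &
     {ae mu, forall x, m - eps <= h x -> g x <= M + eta}) /\
  (forall eps eta, 0 < eps -> 0 < eta ->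
     ~ {ae mu, forall x, m - eps <= h x -> g x <= M - eta}).

(** [M] is the infimum of all a.e. bounds of [g] on some set [m - eps <= h]. The first hypothesis
    says that these sets are not negligible, so no such bound lies below [- K]. *)
Lemma almost_max_slope_exists d (T : measurableType d) (R : realType)
    (mu : {measure set T -> \bar R}) (h : T -> R) (m : R) (g : T -> R) (K : R) :
  (forall eps, 0 < eps -> ~ {ae mu, forall x, h x < m - eps}) ->
  {ae mu, forall x, `|g x| <= K} ->
  exists M, almost_max_slope mu h m g M.
Proof.
move=> hm gK.
pose A := [set y | exists2 eps, 0 < eps &
  {ae mu, forall x, m - eps <= h x -> g x <= y}].
have AK : A K.
  exists 1 => //; apply: filterS gK => x + _.
  by apply: le_trans; exact: ler_norm.
have lbA : lbound A (- K).
  move=> y [eps eps0 Hy]; rewrite leNgt; apply/negP => yK.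
  apply: (hm _ eps0); apply: filterS2 Hy gK => x Hx gx.
  rewrite ltNge; apply/negP => /Hx gy.
  by move: gx; rewrite ler_norml => /andP[]; lra.
have infA : has_inf A by split; [exists K | exists (- K)].
exists (inf A); split.
  move=> eta eta0; have [y [eps eps0 Hy] yM] := inf_adherent eta0 infA.
  exists eps => //; apply: filterS Hy => x /[apply] /le_trans; apply.
  exact: ltW.
move=> eps eta eps0 eta0 H.
have : inf A <= inf A - eta by apply: ge_inf; [exists (- K) | exists eps].
lra.
Qed.

Lemma le_almost_max_slope d (T : measurableType d) (R : realType)
    (mu : {measure set T -> \bar R}) (h : T -> R) (m : R)
    (g g1 g2 : T -> R) (M M1 M2 a b c : R) :
  0 <= a -> 0 <= b ->
  almost_max_slope mu h m g M ->
  almost_max_slope mu h m g1 M1 -> almost_max_slope mu h m g2 M2 ->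
  {ae mu, forall x, g x <= a * g1 x + b * g2 x + c} ->
  M <= a * M1 + b * M2 + c.
Proof.
move=> a0 b0 [_ gM] [gM1 _] [gM2 _] gab; apply/ler_addgt0Pr => e e0.
have ab0 : 0 < a + b + 1 by lra.
(* [g1] and [g2] cost [a * eta] and [b * eta]; one more [eta] is the gap below [M] that contradicts
   [gM]. *)
pose eta := e / (a + b + 1).
have eta0 : 0 < eta by rewrite divr_gt0.
have etaE : e = (a + b + 1) * eta by rewrite /eta mulrC divfK ?gt_eqF.
have [e1 e10 H1] := gM1 _ eta0; have [e2 e20 H2] := gM2 _ eta0.
rewrite leNgt; apply/negP => MM.
apply: (gM (Num.min e1 e2) eta) => //; first by rewrite lt_min e10.
have [m1 m2] : Num.min e1 e2 <= e1 /\ Num.min e1 e2 <= e2.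
  by rewrite !ge_min !lexx orbT.
apply: filterS3 gab H1 H2 => x gx h1 h2 hx.
have {}h1 := h1 (le_trans (lerB (lexx m) m1) hx).
have {}h2 := h2 (le_trans (lerB (lexx m) m2) hx).
have := ler_wpM2l a0 h1; have := ler_wpM2l b0 h2.
move: MM; rewrite etaE; lra.
Qed.

Lemma cvg_ess_sup_on_almost_max d (T : measurableType d) (R : realType)
    (mu : {measure set T -> \bar R}) (h : T -> R) (m : R) (g : T -> R) (M : R) :
  almost_max_slope mu h m g M ->
  ess_sup_on mu [set x | m - eps <= h x] (fun x => (g x)%:E)
    @[eps --> 0^'+] --> M%:E.
Proof.
move=> [gM1 gM2].
have near_M (e : R) : 0 < e -> \forall eps \near 0^'+,
    ((M - e)%:E <= ess_sup_on mu [set x | (m - eps <= h x)%R]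
                     (fun x => (g x)%:E) <= (M + e)%:E)%E.
  move=> e0; have [eps0 eps00 H] := gM1 _ e0; near=> eps.
  have eps_gt0 : 0 < eps by near: eps; exact: nbhs_right_gt.
  apply/andP; split; last first.
    apply/ess_sup_onP; apply: filterS H => x H hx; rewrite lee_fin; apply: H.
    apply: le_trans hx; rewrite lerB//; near: eps; exact: nbhs_right_le.
  rewrite leNgt; apply/negP => /ltW/ess_sup_onP H'.
  by apply: (gM2 _ _ eps_gt0 e0); apply: filterS H' => x /[apply].
apply/fine_cvgP; split.
  near=> eps; have /andP[l r] : ((M - 1)%:E <= ess_sup_on mu
      [set x | (m - eps <= h x)%R] (fun x => (g x)%:E) <= (M + 1)%:E)%E.
    by near: eps; exact: near_M.
  by rewrite fin_numElt (lt_le_trans _ l) ?ltNyr// (le_lt_trans r) ?ltry.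
apply/cvgrPdist_le => e e0; near=> eps.
have /andP[l r] : ((M - e)%:E <= ess_sup_on mu
    [set x | (m - eps <= h x)%R] (fun x => (g x)%:E) <= (M + e)%:E)%E.
  by near: eps; exact: near_M.
have E : ess_sup_on mu [set x | (m - eps <= h x)%R] (fun x => (g x)%:E)
    \is a fin_num.
  by rewrite fin_numElt (lt_le_trans _ l) ?ltNyr// (le_lt_trans r) ?ltry.
move: l r => /=; rewrite -(fineK E) !lee_fin distrC ler_distl => -> -> //.
Unshelve. all: by end_near. Qed.

(* Near the set where h is almost maximal, h + t g exceeds m by about t g; away
   from it, h + t g stays below m for small t because g is bounded. *)
Lemma ess_max_expansion d (T : measurableType d) (R : realType)
    (mu : {measure set T -> \bar R}) (h : T -> R) (m : R) (g : T -> R)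
    (M K : R) (ht : R -> T -> R) (mt : R -> R) :
  {ae mu, forall x, h x <= m} ->
  (forall t, {ae mu, forall x, ht t x <= mt t}) ->
  (forall t y, {ae mu, forall x, ht t x <= y} -> mt t <= y) ->
  {ae mu, forall x, `|g x| <= K} ->
  almost_max_slope mu h m g M ->
  (forall e, 0 < e -> \forall t \near 0^'+,
     {ae mu, forall x, `|ht t x - h x - t * g x| <= e * t}) ->
  (mt t - m) / t @[t --> 0^'+] --> M.
Proof.
move=> hm htmt mtle gK [gM1 gM2] hg.
apply/cvgrPdist_le => e e0.
have e20 : 0 < e / 2 by rewrite divr_gt0.
have [eps eps0 gM] := gM1 _ e20.
have K0 : 0 < `|K| + `|M| + 1 by rewrite ltr_pwDr// addr_ge0.
(* For such [t], where [h < m - eps], the loss [eps] outweighs the largest possible excess of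
   [t * g] over [t * M]. *)
have small : \forall t \near (0:R)^'+, t * (`|K| + `|M| + 1) <= eps.
  near=> t; rewrite -ler_pdivlMr//; near: t; apply: nbhs_right_le.
  by rewrite divr_gt0.
near=> t.
have t0 : 0 < t by near: t; exact: nbhs_right_gt.
have eps_t : t * (`|K| + `|M| + 1) <= eps by near: t.
have Ht : {ae mu, forall x, `|ht t x - h x - t * g x| <= e / 2 * t}.
  by near: t; exact: hg.
have up : mt t <= m + t * M + e * t.
  have gHt : {ae mu, forall x, `|g x| <= K /\ `|ht t x - h x - t * g x| <= e / 2 * t}.
    by apply: filterS2 gK Ht.
  apply: mtle.
  apply: filterS3 hm gM gHt => x hx gx [gKx]; rewrite ler_norml => /andP[_ htx].
  have [/gx{}gx|hlt] := leP (m - eps) (h x).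
    by have := ler_wpM2l (ltW t0) gx; lra.
  have gKM : g x <= `|K| + `|M| + 1 + M.
    have := ler_norm K; have := ler_norm (- M); rewrite normrN.
    have := ler_norm (g x); lra.
  have := ler_wpM2l (ltW t0) gKM; have := mulr_ge0 (ltW e0) (ltW t0); lra.
have lo : m + t * M - e * t <= mt t.
  rewrite leNgt; apply/negP => mtlt.
  (* Of the deficit [e * t], a quarter goes to [m - h] and a half to the expansion error; the last
     quarter keeps [g] below [M - e / 4]. *)
  apply: (gM2 (e / 4 * t) (e / 4)); rewrite ?mulr_gt0 ?divr_gt0//.
  apply: filterS2 (htmt t) Ht => x htx; rewrite ler_norml => /andP[Hx _] hx.
  rewrite leNgt; apply/negP => gx.
  have := ler_wpM2l (ltW t0) (ltW gx); lra.
rewrite distrC ler_norml; apply/andP; split.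
  by rewrite lerBrDr ler_pdivlMr//; lra.
by rewrite lerBlDr ler_pdivrMr//; lra.
Unshelve. all: by end_near. Qed.

(** * First-order expansions holding almost everywhere *)

Lemma cvge0_near_le (R : realType) (T : Type) (G : set_system T)
    {FG : Filter G} (f : T -> \bar R) (e : R) :
  f @ G --> 0%E -> 0 < e -> \forall x \near G, (f x <= e%:E)%E.
Proof.
move=> f0 e0; have : \forall x \near G, (f x < e%:E)%E.
  by apply: (f0 [set y | (y < e%:E)%E]); apply: open_ereal_lt'; rewrite lte_fin.
by apply: filterS => x /ltW.
Qed.

Lemma continuously_differentiable_cvg (R : realType) (X : normedModType R)
    (g : X -> R) (v phi : X) :
  continuously_differentiable g -> 'd g w phi @[w --> v] --> 'd g v phi.
Proof.
move=> [_ gC]; apply/cvgrPdist_le => e e0.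
(* The dual norm only sees the unit ball. Scaling by the norm of [phi] plus one also covers
   [phi = 0]. *)
have [k [psi [k0 psi1 ->]]] : exists k psi, [/\ 0 < k, `|psi| <= 1 & phi = k *: psi].
  have p0 : 0 < `|phi| + 1 by rewrite ltr_wpDl.
  exists (`|phi| + 1), ((`|phi| + 1)^-1 *: phi); split => //.
    by rewrite normrZ gtr0_norm ?invr_gt0// mulrC ler_pdivrMr// mul1r lerDl.
  by rewrite scalerA divff ?gt_eqF// scale1r.
near=> w.
have Hw : (dual_norm (fun psi => ('d g w psi - 'd g v psi)%R) <= (e / k)%:E)%E.
  by near: w; apply: cvge0_near_le (gC v) _; rewrite divr_gt0.
have Hpsi : `|'d g w psi - 'd g v psi| <= e / k.
  rewrite -lee_fin; apply: le_trans Hw; apply: ereal_sup_ubound.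
  by exists psi.
have dE z : 'd g z (k *: psi) = k * 'd g z psi by exact: linearZ.
rewrite distrC !dE -mulrBr normrM gtr0_norm//.
by rewrite mulrC -ler_pdivlMr.
Unshelve. all: by end_near. Qed.

Lemma is_derive_line (R : realType) (X : normedModType R) (g : X -> R)
    (u phi : X) (s : R) :
  differentiable g (u + s *: phi) ->
  is_derive s 1 (fun s => g (u + s *: phi)) ('d g (u + s *: phi) phi).
Proof.
move=> dg; have H : (fun h : R => h^-1 *: ((g \o shift (u + s *: phi)) (h *: phi)
    - g (u + s *: phi))) = (fun h : R => h^-1 *: (((fun r => g (u + r *: phi)) \o
    shift s) (h *: 1) - g (u + s *: phi))).
  apply/funext => h /=; congr (_ *: (g _ - _)).
  by rewrite /shift/= scalerDl addrCA [h *: 1]mulr1.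
split.
  by have := diff_derivable (v := phi) dg; rewrite /derivable H.
by rewrite -deriveE// /derive H.
Qed.

(* By continuity of the differential the bound only has to be known at the
   rational points of the segment, so that it survives almost everywhere
   quantification; the mean value theorem does the rest. *)
Lemma segment_first_order (R : realType) (X : normedModType R) (g : X -> R)
    (u phi : X) (t e : R) :
  continuously_differentiable g -> 0 < t ->
  (forall q : rat, 0 < (ratr q : R) < t ->
     `|'d g (u + ratr q *: phi) phi - 'd g u phi| <= e) ->
  `|g (u + t *: phi) - g u - t * 'd g u phi| <= e * t.
Proof.
move=> gC t0 He.
have line_cvg (s : R) : u + r *: phi @[r --> s] --> u + s *: phi.
  by apply: cvgD; [exact: cvg_cst|apply: cvgZl; exact: cvg_id].
have He' (s : R) : 0 < s < t -> `|'d g (u + s *: phi) phi - 'd g u phi| <= e.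
  move=> /andP[s0 st]; rewrite leNgt; apply/negP => es.
  have cs : `|'d g (u + r *: phi) phi - 'd g u phi| @[r --> s] -->
      `|'d g (u + s *: phi) phi - 'd g u phi|.
    apply: cvg_norm; apply: cvgB; last exact: cvg_cst.
    apply: (@cvg_comp _ _ _ (fun r => u + r *: phi) (fun w => 'd g w phi)
      _ _ _ (line_cvg s)).
    exact: continuously_differentiable_cvg.
  have /nbhs_ballP[r /= r0 Hr] : \forall r \near s,
      e < `|'d g (u + r *: phi) phi - 'd g u phi|.
    exact: (cvgr_gt _ cs _ es).
  (* Strict failure at [s] persists within distance [r]; a rational just right of [s] and below [t]
     contradicts [He]. *)
  have [q] := @rat_in_itvoo R s (Num.min (s + r) t) ltac:(by rewrite lt_min st ltrDl r0).
  rewrite in_itv/= lt_min => /and3P[sq qr qt].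
  have := He q; rewrite qt (lt_trans s0 sq) => /(_ isT).
  rewrite leNgt => /negP; apply; apply: Hr.
  by rewrite /ball/= ltr_distlC; apply/andP; split; lra.
have dline (s : R) : is_derive s 1 (fun s => g (u + s *: phi))
    ('d g (u + s *: phi) phi) by apply: is_derive_line; exact: gC.1.
have cline : {within `[0, t], continuous (fun s => g (u + s *: phi))}.
  apply: continuous_subspaceT => s.
  apply: (@cvg_comp _ _ _ (fun r => u + r *: phi) g _ _ _ (line_cvg s)).
  exact: differentiable_continuous (gC.1 _).
have [c] := MVT t0 (fun s _ => dline s) cline.
rewrite in_itv/= => /He' Hc; rewrite scale0r addr0 subr0 => ->.
rewrite (mulrC t) -mulrBl normrM (gtr0_norm t0).
by rewrite ler_pM2r.
Qed.

(** Each point of the segment has its own exceptional null set. Using only the rational points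
    leaves a countable union, which is still null, and [segment_first_order] then applies outside
    it. *)
Lemma ae_first_order (R : realType) (X : normedModType R)
    d (T : measurableType d) (mu : {measure set T -> \bar R})
    (F : X -> T -> R) (u phi : X) (e : R) :
  {ae mu, forall x, continuously_differentiable (F ^~ x)} ->
  ess_sup mu (fun x => (`| 'd (F ^~ x) w phi - 'd (F ^~ x) u phi |)%:E)
    @[w --> u] --> 0%E ->
  0 < e ->
  \forall t \near 0^'+, {ae mu, forall x,
    `|F (u + t *: phi) x - F u x - t * 'd (F ^~ x) u phi| <= e * t}.
Proof.
move=> FC dF e0.
have line0 : u + r *: phi @[r --> (0:R)] --> u.
  rewrite -[X in _ --> X]addr0 -[X in _ --> _ + X](scale0r phi).
  by apply: cvgD; [exact: cvg_cst|apply: cvgZl; exact: cvg_id].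
have /nbhs_ballP[r /= r0 Hr] : \forall r \near (0 : R),
    (ess_sup mu (fun x => (`| 'd (F ^~ x) (u + r *: phi) phi
       - 'd (F ^~ x) u phi |)%R%:E) <= e%:E)%E.
  exact: (line0 _ (cvge0_near_le dF e0)).
near=> t.
have t0 : 0 < t by near: t; exact: nbhs_right_gt.
have tr : t < r by near: t; exact: nbhs_right_lt.
have Hq : {ae mu, forall x, forall q : rat, 0 < (ratr q : R) < t ->
    `|'d (F ^~ x) (u + ratr q *: phi) phi - 'd (F ^~ x) u phi| <= e}.
  (* The rationals are enumerated by their codes; a natural number coding none imposes no
     condition. *)
  have : {ae mu, forall x, forall n : nat, forall q : rat, unpickle n = Some q ->
      0 < (ratr q : R) < t ->
     `|'d (F ^~ x) (u + ratr q *: phi) phi - 'd (F ^~ x) u phi| <= e}.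
    apply: ae_foralln => n.
    case: (unpickle n : option rat) => [q|]; last by apply: aeW.
    have [/andP[q0 qt]|qt] := boolP (0 < (ratr q : R) < t); last first.
      by apply: aeW => x _ [<-]; rewrite (negbTE qt).
    have /Hr/ess_supP : ball 0 r (ratr q : R).
      by rewrite /ball/= sub0r normrN gtr0_norm// (lt_trans qt).
    by apply: filterS => x + _ [<-] _; rewrite lee_fin.
  by apply: filterS => x Hx q; apply: (Hx (pickle q)); rewrite pickleK.
apply: filterS2 FC Hq => x FCx Hx.
exact: segment_first_order FCx t0 Hx.
Unshelve. all: by end_near. Qed.

(** * Finiteness of the envelope *)

(** An essential bound [C] brackets the supremum between [- C] and [C]. Positivity of the measure
    gives the lower bound: over a null space the supremum is [-oo]. *)
Lemma ess_sup_envelope (R : realType) (X : Type) d (T : measurableType d)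
    (mu : {measure set T -> \bar R}) (F : X -> T -> R) (u : X) :
  (0 < mu setT)%E -> F u \in Lfun mu +oo%E ->
  ess_sup mu (fun x => (F u x)%:E) = (envelope mu F u)%:E.
Proof.
move=> mu0 /andP[_]; rewrite inE /= /finite_norm unlock mu0.
rewrite (_ : abse \o _ = EFin \o (Num.norm \o F u)); last exact/funext.
move=> /ess_supr_bounded[C FC]; rewrite /envelope fineK// fin_numElt.
apply/andP; split.
  apply: (@lt_le_trans _ _ (- C)%:E); first exact: ltNyr.
  apply: ess_sup_gee => //; apply: filterS FC => x.
  by rewrite lee_fin ler_norml => /andP[].
apply: (@le_lt_trans _ _ C%:E); last exact: ltry.
apply/ess_supP; apply: filterS FC => x.
by rewrite lee_fin ler_norml => /andP[].
Qed.

(** * From Gateaux to Penot and Hadamard semi-differentials *)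

Lemma semidifferentialE (R : realType) (X : normedModType R) (f : X -> R)
    (u phi : X) (M : R) :
  diff_quotient f u phi t @[t --> 0^'+] --> M -> semidifferential f u phi = M.
Proof. by move=> fM; apply: cvg_lim. Qed.

(** Difference quotients in the directions [psi] and [phi] differ by at most [L] times the distance
    of [psi] to [phi], uniformly in small [t]. *)
Lemma penot_of_lipschitz (R : realType) (X : normedModType R) (f : X -> R)
    (u phi : X) (r L M : R) :
  0 < r -> 0 < L ->
  (forall v w, ball u r v -> ball u r w -> `|f v - f w| <= L * `|v - w|) ->
  diff_quotient f u phi t @[t --> 0^'+] --> M ->
  penot_semidifferentiable f u phi.
Proof.
move=> r0 L0 fL fM; rewrite /penot_semidifferentiable (semidifferentialE fM).
apply/cvgrPdist_le => e e0.
have e20 : 0 < e / 2 by rewrite divr_gt0.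
have phi0 : 0 < `|phi| + 1 by rewrite ltr_wpDl.
(* The bound on [t] keeps [u + t *: psi] in the ball of radius [r] for every [psi] within distance 1
   of [phi]. *)
pose A := [set t : R | [/\ 0 < t, t < r / (`|phi| + 1) &
  `|M - diff_quotient f u phi t| <= e / 2]].
pose B := [set psi : X | `|phi - psi| <= 1 /\ `|phi - psi| <= e / 2 / L].
exists (A, B); first split => /=.
- near=> t; split.
  + by near: t; exact: nbhs_right_gt.
  + by near: t; apply: nbhs_right_lt; rewrite divr_gt0.
  + by near: t; move/cvgrPdist_le : fM; apply.
- have phi_id : psi @[psi --> phi] --> phi by exact: cvg_id.
  near=> psi; split; near: psi; move/cvgrPdist_le : phi_id; apply => //.
  by rewrite !divr_gt0.
move=> [t psi] /= [[t0 tr tM] [psi1 psie]].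
have psiN : `|psi| <= `|phi| + 1.
  by rewrite -[psi](subKr phi) (le_trans (ler_normB _ _))// lerD2l.
have tphi w : `|w| <= `|phi| + 1 -> ball u r (u + t *: w).
  move=> wN; rewrite -ball_normE /ball_ /= opprD addrA subrr sub0r normrN normrZ.
  rewrite gtr0_norm// (le_lt_trans (ler_wpM2l (ltW t0) wN))//.
  by rewrite -ltr_pdivlMr.
have Hf := fL _ _ (tphi _ psiN) (tphi phi ltac:(by rewrite lerDl)).
have -> : M - diff_quotient f u psi t = (M - diff_quotient f u phi t) -
    (f (u + t *: psi) - f (u + t *: phi)) / t.
  rewrite /diff_quotient; ring.
rewrite (le_trans (ler_normB _ _))// [leRHS]splitr lerD//.
rewrite normrM normfV (gtr0_norm t0) ler_pdivrMr// (le_trans Hf)//.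
rewrite opprD addrACA subrr add0r -scalerBr normrZ (gtr0_norm t0) distrC.
by rewrite mulrCA [leRHS]mulrC ler_pM2l// [leLHS]mulrC -ler_pdivlMr.
Unshelve. all: by end_near. Qed.

(** A path is [u + t *: psi] with the moving direction [psi = t^-1 *: (c t - c 0)], which tends to
    [phi]. *)
Lemma penot_hadamard (R : realType) (X : normedModType R) (f : X -> R)
    (u phi : X) :
  penot_semidifferentiable f u phi -> hadamard_semidifferentiable f u phi.
Proof.
move=> fP t0 c t00 c0 cphi.
have : diff_quotient f u (t^-1 *: (c t - c 0)) t @[t --> 0^'+] -->
    semidifferential f u phi.
  apply: (@cvg_comp _ _ _ (fun t => (t, t^-1 *: (c t - c 0)))
    (fun p => diff_quotient f u p.2 p.1) _ _ _ _ fP).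
  by apply: cvg_pair => //; exact: cvg_id.
apply: cvg_trans; apply: near_eq_cvg; near=> t.
have t_gt0 : 0 < t by near: t; exact: nbhs_right_gt.
rewrite /diff_quotient scalerA divff ?gt_eqF// scale1r c0.
by rewrite [u + _]addrC subrK.
Unshelve. all: by end_near. Qed.

(** * Bounds for the envelope and for the slopes *)

Lemma envelope_leP (R : realType) (X : Type) d (T : measurableType d)
    (mu : {measure set T -> \bar R}) (F : X -> T -> R) (u : X) (y : R) :
  ess_sup mu (fun x => (F u x)%:E) = (envelope mu F u)%:E ->
  envelope mu F u <= y <-> {ae mu, forall x, F u x <= y}.
Proof.
move=> FE; rewrite -lee_fin -FE; split => [/ess_supP|H]; last apply/ess_supP.
  by apply: filterS => x; rewrite lee_fin.
by apply: filterS H => x; rewrite lee_fin.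
Qed.

Lemma envelope_lipschitz (R : realType) (X : Type) d
    (T : measurableType d) (mu : {measure set T -> \bar R}) (F : X -> T -> R)
    (u v : X) (l : R) :
  (forall w, ess_sup mu (fun x => (F w x)%:E) = (envelope mu F w)%:E) ->
  {ae mu, forall x, `|F u x - F v x| <= l} ->
  `|envelope mu F u - envelope mu F v| <= l.
Proof.
move=> FE Fl; have Fle w := (envelope_leP (envelope mu F w) (FE w)).1 (lexx _).
have uv : envelope mu F u <= envelope mu F v + l.
  apply/(envelope_leP _ (FE _)).
  by apply: filterS2 Fl (Fle v) => x; rewrite ler_norml => /andP[_ +]; lra.
have vu : envelope mu F v <= envelope mu F u + l.
  apply/(envelope_leP _ (FE _)).
  by apply: filterS2 Fl (Fle u) => x; rewrite ler_norml => /andP[+ _]; lra.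
by rewrite ler_norml; apply/andP; split; lra.
Qed.

(** A single small [t] suffices: the increment of [F] is at most [L * t] times the norm of [phi],
    and the [+ 1] pays for the expansion error, whose rate is chosen to be that norm. *)
Lemma ae_differential_bounded (R : realType) (X : normedModType R)
    d (T : measurableType d) (mu : {measure set T -> \bar R})
    (F : X -> T -> R) (u : X) (r L : R) :
  {ae mu, forall x, continuously_differentiable (F ^~ x)} ->
  (forall phi, ess_sup mu
     (fun x => (`| 'd (F ^~ x) w phi - 'd (F ^~ x) u phi |)%:E)
    @[w --> u] --> 0%E) ->
  0 < r ->
  (forall v, ball u r v ->
    {ae mu, forall x, `|F v x - F u x| <= L * `|v - u|}) ->
  forall phi, {ae mu, forall x, `|'d (F ^~ x) u phi| <= (L + 1) * `|phi|}.
Proof.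
move=> FC dF r0 FL phi; have [->|phi0] := eqVneq phi 0.
  by apply: aeW => x; rewrite linear0 !normr0 mulr0.
have np0 : 0 < `|phi| by rewrite normr_gt0.
have fo := ae_first_order FC (dF phi) np0.
near (at_right (0 : R)) => t.
have t0 : 0 < t by near: t; exact: nbhs_right_gt.
have Ht : {ae mu, forall x,
   `|F (u + t *: phi) x - F u x - t * 'd (F ^~ x) u phi| <= `|phi| * t}.
  by near: t.
have Hb : ball u r (u + t *: phi).
  rewrite -ball_normE /ball_ /= opprD addrA subrr sub0r normrN normrZ.
  rewrite gtr0_norm// -ltr_pdivlMr//.
  by near: t; apply: nbhs_right_lt; rewrite divr_gt0.
apply: filterS2 Ht (FL _ Hb) => x Hx.
rewrite addrAC subrr add0r normrZ (gtr0_norm t0) => Lx.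
have tx : t * `|'d (F ^~ x) u phi| <= t * ((L + 1) * `|phi|).
  rewrite -{1}(gtr0_norm t0) -normrM.
  rewrite -[t * 'd _ _ _](subKr (F (u + t *: phi) x - F u x)).
  by rewrite (le_trans (ler_normB _ _))//; lra.
by rewrite ler_pM2l in tx.
Unshelve. all: by end_near. Qed.

(** * Semi-differentials of the envelope: existence, formula, dependence on the direction *)

Theorem proposition23 (R : realType) (X : completeNormedModType R)
  (d : measure_display) (Omega : measurableType d)
  (lambda : {measure set Omega -> \bar R})
  (lambda_gt0 : (0 < lambda setT)%E)
  (F : X -> Omega -> R)
  (F_Linfty : forall u : X, F u \in Lfun lambda +oo%E)
  (F_C1 : {ae lambda, forall x : Omega,
             continuously_differentiable (F ^~ x)})
  (dF_cont : forall v phi : X,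
     ess_sup lambda (fun x : Omega =>
       (`| 'd (F ^~ x) w phi - 'd (F ^~ x) v phi |)%:E)
     @[w --> v] --> 0%E)
  (F_cont : forall v : X,
     ess_sup lambda (fun x : Omega => (`| F w x - F v x |)%:E)
     @[w --> v] --> 0%E)
  (F_Lip : forall r : R, 0 < r -> exists2 L : R, 0 < L &
     forall u v : X, ball (0 : X) r u -> ball (0 : X) r v ->
       (ess_sup lambda (fun x : Omega => (`| F u x - F v x |)%:E)
          <= (L * `|u - v|)%:E)%E) :
  let f : X -> R := envelope lambda F in
  let Df : X -> X -> R := semidifferential f in
  [/\ (forall u : X, ess_sup lambda (fun x : Omega => (F u x)%:E) = (f u)%:E),
      (forall u phi : X, hadamard_semidifferentiable f u phi /\
                         penot_semidifferentiable f u phi),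
      (forall u phi : X,
         ess_sup_on lambda (almost_max lambda F u eps)
           (fun x : Omega => ('d (F ^~ x) u phi)%:E)
         @[eps --> 0^'+] --> (Df u phi)%:E)
    & (forall u : X,
         [/\ (forall (t : R) (phi : X), 0 < t ->
                Df u (t *: phi) = t * Df u phi),
             continuous (Df u)
           & convex_function setT (Df u)])].
Proof.
move=> f Df.
have FE u : ess_sup lambda (fun x => (F u x)%:E) = (f u)%:E.
  exact: ess_sup_envelope.
have FLip u : exists2 L, 0 < L & forall v w, ball u 1 v -> ball u 1 w ->
    {ae lambda, forall x, `|F v x - F w x| <= L * `|v - w|}.
  (* The centred ball of this radius contains the unit ball around [u]. *)
  have u1 : 0 < `|u| + 1 by rewrite ltr_wpDl.
  have [L L0 HL] := F_Lip _ u1; exists L => // v w uv uw.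
  have sub z : ball u 1 z -> ball (0 : X) (`|u| + 1) z.
    rewrite -!ball_normE /ball_ /= sub0r normrN => uz.
    by rewrite -[z](subKr u) (le_lt_trans (ler_normB _ _))// ltrD2l.
  have /ess_supP := HL _ _ (sub _ uv) (sub _ uw).
  by apply: filterS => x; rewrite lee_fin.
have fLip u : exists2 L, 0 < L & forall v w, ball u 1 v -> ball u 1 w ->
    `|f v - f w| <= L * `|v - w|.
  have [L L0 HL] := FLip u; exists L => // v w uv uw.
  by apply: envelope_lipschitz => //; exact: HL.
have dFb u : exists2 K, 0 < K & forall phi,
    {ae lambda, forall x, `|'d (F ^~ x) u phi| <= K * `|phi|}.
  have [L L0 HL] := FLip u; exists (L + 1); first by rewrite addr_gt0.
  apply: (ae_differential_bounded F_C1 (dF_cont u) ltr01) => v uv.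
  by apply: HL => //; exact: ballxx.
have slopeE u phi : exists M,
    almost_max_slope lambda (F u) (f u) (fun x => 'd (F ^~ x) u phi) M.
  have [K _ /(_ phi) HK] := dFb u; apply: almost_max_slope_exists HK => eps eps0.
  (* Almost maximal points are not negligible, as [f u] is the least a.e. upper bound of [F u]. *)
  move=> H; have : f u <= f u - eps; last by lra.
  by apply/(envelope_leP _ (FE u)); apply: filterS H => x /ltW.
have gateaux u phi M :
    almost_max_slope lambda (F u) (f u) (fun x => 'd (F ^~ x) u phi) M ->
    diff_quotient f u phi t @[t --> 0^'+] --> M.
  have [K _ /(_ phi) HK] := dFb u => HM.
  apply: (ess_max_expansion (ht := fun t => F (u + t *: phi)) _ _ _ HK HM).
  - exact: (envelope_leP _ (FE u)).1 (lexx _).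
  - by move=> t; apply: (envelope_leP _ (FE _)).1 (lexx _).
  - by move=> t y /(envelope_leP _ (FE _)).
  - by move=> e; exact: ae_first_order.
have slope u phi :
    almost_max_slope lambda (F u) (f u) (fun x => 'd (F ^~ x) u phi) (Df u phi).
  by have [M HM] := slopeE u phi; rewrite /Df (semidifferentialE (gateaux _ _ _ HM)).
(* Homogeneity takes [b = c = 0], continuity [a = 1] and [b = 0], convexity [c = 0]. *)
have leDf u phi phi1 phi2 a b c : 0 <= a -> 0 <= b ->
    {ae lambda, forall x, 'd (F ^~ x) u phi <=
       a * 'd (F ^~ x) u phi1 + b * 'd (F ^~ x) u phi2 + c} ->
    Df u phi <= a * Df u phi1 + b * Df u phi2 + c.
  by move=> a0 b0; exact: le_almost_max_slope (slope u phi) (slope u phi1) (slope u phi2).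
split => //.
- move=> u phi; have fP : penot_semidifferentiable f u phi.
    have [L L0 HL] := fLip u.
    exact: penot_of_lipschitz ltr01 L0 HL (gateaux _ _ _ (slope u phi)).
  by split => //; exact: penot_hadamard.
- by move=> u phi; exact: cvg_ess_sup_on_almost_max (slope u phi).
move=> u; split.
- have le t phi : 0 < t -> Df u (t *: phi) <= t * Df u phi.
    move=> t0; have := @leDf u (t *: phi) phi phi t 0 0 (ltW t0) (lexx _).
    rewrite mul0r !addr0; apply; apply: aeW => x.
    by rewrite linearZ mul0r !addr0.
  (* The reverse inequality is [le] for the factor [t^-1] and the direction [t *: phi]. *)
  move=> t phi t0; apply/eqP; rewrite eq_le le//=.
  have := le t^-1 (t *: phi); rewrite invr_gt0 => /(_ t0).
  by rewrite scalerA mulVf ?gt_eqF// scale1r mulrC ler_pdivlMr// mulrC.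
- have [K K0 HK] := dFb u.
  (* The a.e. bound on the differential in the direction [phi - psi] makes [Df u] Lipschitz with
     constant [K]. *)
  have le phi psi : Df u phi <= Df u psi + K * `|phi - psi|.
    have := @leDf u phi psi psi 1 0 (K * `|phi - psi|) ler01 (lexx _).
    rewrite mul0r mul1r addr0; apply; apply: filterS (HK (phi - psi)) => x.
    rewrite linearB /= mul0r mul1r addr0 -lerBlDl; apply: le_trans.
    exact: ler_norm.
  move=> phi; apply/cvgrPdist_le => e e0; near=> psi.
  have psie : K * `|phi - psi| <= e.
    rewrite mulrC -ler_pdivlMr//; near: psi.
    have phi_id : psi @[psi --> phi] --> phi by exact: cvg_id.
    by move/cvgrPdist_le : phi_id; apply; rewrite divr_gt0.
  have := le phi psi; have := le psi phi; rewrite [`|psi - _|]distrC.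
  by move=> ? ?; rewrite ler_norml; apply/andP; split; lra.
- move=> t phi psi _ _; rewrite convRE.
  have t0 : 0 <= t%:inum by [].
  have t1 : 0 <= 1 - t%:inum by rewrite subr_ge0.
  have := @leDf u (t%:inum *: phi + (1 - t%:inum) *: psi) phi psi _ _ 0 t0 t1.
  rewrite addr0; apply; apply: aeW => x.
  by rewrite addr0 linearD !linearZ.
Unshelve. all: by end_near. Qed.
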